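(* Let $(C,X,F,Y)$ be random elements of standard Borel spaces such that $F-(X,C)-Y$ is a Markov chain. Whenever the conditional relative entropies are well defined, $$D_p(X\to Y\mid C)=I(F;X\mid Y,C).$$ If the mutual-information terms are finite, then $$I(F;X\mid C)=I(F;Y\mid C)+D_p(X\to Y\mid C).$$
   Context: All random elements take values in standard Borel spaces, with measurable versions of regular conditional distributions fixed. $F-(X,C)-Y$ means that $F$ and $Y$ are conditionally independent given $(X,C)$. $P_{F\mid X,C}$ and $P_{F\mid Y,C}$ denote the conditional laws of $F$ given $(X,C)$ and given $(Y,C)$. The expected log-loss predictive distortion is $$D_p(X\to Y\mid C)\triangleq\mathbb E\left[D_{\mathrm{KL}}\left(P_{F\mid X,C}(\cdot\mid X,C)\,\middle\|\,P_{F\mid Y,C}(\cdot\mid Y,C)\right)\right],$$ where $D_{\mathrm{KL}}(P\|Q)$ is relative entropy, equal to $+\infty$ when $P$ is not absolutely continuous with respect to $Q$. $I(\cdot;\cdot\mid\cdot)$ is conditional mutual information, with the same logarithm base as $D_{\mathrm{KL}}$. *)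

(* Defs.v *)
From HB Require Import structures.
From mathcomp Require Import all_boot all_order all_algebra.
From mathcomp Require Import all_classical all_reals all_analysis.

Set Implicit Arguments.
Unset Strict Implicit.
Unset Printing Implicit Defensive.

Import Order.TTheory GRing.Theory Num.Theory.

Local Open Scope classical_set_scope.
Local Open Scope ring_scope.
Local Open Scope ereal_scope.

Definition polish (R : realType) (M : metricType R) : Prop :=
  (forall F : set_system M, ProperFilter F -> cauchy F ->
     exists x : M, F --> x) /\
  (exists2 D : set M, countable D & dense D).

Definition standard_borel (R : realType) (d : measure_display)
    (T : measurableType d) : Prop :=
  exists M : metricType R, polish M /\
  exists2 f : T -> M, bijective f &
    forall B : set M, <<s open >> B <-> measurable (f @^-1` B).

Section random_pair.
Context (dO d1 d2 : measure_display) (Om : measurableType dO)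
  (T1 : measurableType d1) (T2 : measurableType d2).
Variables (X : {mfun Om >-> T1}) (Y : {mfun Om >-> T2}).

Definition rpair (w : Om) : T1 * T2 := (X w, Y w).

Let measurable_rpair : measurable_fun setT rpair.
Proof. exact: measurable_fun_pair. Qed.

HB.instance Definition _ :=
  isMeasurableFun.Build _ _ _ _ rpair measurable_rpair.

End random_pair.

(* Regular conditional distribution of U given W: a Markov kernel, i.e. a
   measurable map into the space of probability measures, that disintegrates
   the joint law of (U, W).  Its inhabitants are the versions of P_{U|W}. *)
Record rcd (R : realType) (dO dU dW : measure_display)
    (Om : measurableType dO) (TU : measurableType dU) (TW : measurableType dW)
    (P : probability Om R) (U : {mfun Om >-> TU}) (W : {mfun Om >-> TW}) := Rcd {
  rcd_kernel : {mfun TW >-> pprobability TU R} ;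
  rcd_disintegration : forall (A : set TU) (B : set TW),
    measurable A -> measurable B ->
    P (U @^-1` A `&` W @^-1` B) =
      \int[distribution P W]_(w in B) (rcd_kernel w : probability TU R) A }.

Definition condlaw (R : realType) (dO dU dW : measure_display)
    (Om : measurableType dO) (TU : measurableType dU) (TW : measurableType dW)
    (P : probability Om R) (U : {mfun Om >-> TU}) (W : {mfun Om >-> TW})
    (k : rcd P U W) (w : TW) : probability TU R := rcd_kernel k w.

(* g is a version of w |-> P(E | W = w). *)
Definition is_cond_prob (R : realType) (dO dW : measure_display)
    (Om : measurableType dO) (TW : measurableType dW) (P : probability Om R)
    (E : set Om) (W : {mfun Om >-> TW}) (g : TW -> \bar R) : Prop :=
  (distribution P W).-integrable setT g /\
  forall B : set TW, measurable B ->
    P (E `&` W @^-1` B) = \int[distribution P W]_(w in B) g w.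

(* P(U in A, V in B | W) = P(U in A | W) P(V in B | W) almost surely.  Versions
   of a conditional probability exist and are almost surely unique, so the
   choice of gA and gB is immaterial. *)
Definition cond_indep (R : realType) (dO dU dV dW : measure_display)
    (Om : measurableType dO) (TU : measurableType dU) (TV : measurableType dV)
    (TW : measurableType dW) (P : probability Om R) (U : {mfun Om >-> TU})
    (V : {mfun Om >-> TV}) (W : {mfun Om >-> TW}) : Prop :=
  forall (A : set TU) (B : set TV), measurable A -> measurable B ->
  exists gA gB : TW -> \bar R,
    [/\ is_cond_prob P (U @^-1` A) W gA,
        is_cond_prob P (V @^-1` B) W gB &
        is_cond_prob P (U @^-1` A `&` V @^-1` B) W (fun w => gA w * gB w)].

(* The derivative is finite everywhere and positive mu-almost everywhere, so
   neither fine nor the value of ln outside ]0, +oo[ matters.  The negative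
   part of the integrand is mu-integrable, so the integral is never of the
   form +oo - +oo. *)
Definition kl (R : realType) (b : R) (d : measure_display)
    (T : measurableType d) (mu nu : probability T R) : \bar R :=
  if `[< mu `<< nu >] then
    \int[mu]_x
      (ln (fine (Radon_Nikodym (charge_of_finite_measure mu) nu x)) / ln b)%:E
  else +oo.

(* kl takes values in [0, +oo], so the expectations below need no integrability
   condition; over standard Borel spaces their integrands are measurable. *)
Definition pred_distortion (R : realType) (b : R)
    (dO dC dX dF dY : measure_display) (Om : measurableType dO)
    (TC : measurableType dC) (TX : measurableType dX) (TF : measurableType dF)
    (TY : measurableType dY) (P : probability Om R) (C : {mfun Om >-> TC})
    (X : {mfun Om >-> TX}) (F : {mfun Om >-> TF}) (Y : {mfun Om >-> TY})
    (kF_XC : rcd P F (rpair X C)) (kF_YC : rcd P F (rpair Y C)) : \bar R :=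
  \int[P]_w kl b (condlaw kF_XC (X w, C w)) (condlaw kF_YC (Y w, C w)).

Definition cond_mutual_info (R : realType) (b : R)
    (dO dU dV dW : measure_display) (Om : measurableType dO)
    (TU : measurableType dU) (TV : measurableType dV) (TW : measurableType dW)
    (P : probability Om R) (U : {mfun Om >-> TU}) (V : {mfun Om >-> TV})
    (W : {mfun Om >-> TW}) (kUV : rcd P (rpair U V) W)
    (kU : rcd P U W) (kV : rcd P V W) : \bar R :=
  \int[P]_w kl b (condlaw kUV (W w))
                 (condlaw kU (W w) \x condlaw kV (W w) : probability _ _).

(* Main.v *)
From HB Require Import structures.
Require Import Defs.
From mathcomp Require Import all_boot all_order all_algebra.
From mathcomp Require Import all_classical all_reals all_analysis.
From mathcomp Require Import measurable_realfun giry kernel lra.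

(** Every term is a relative entropy of joint laws. For a law lam on W and Markov
    kernels k, e from W to a countably generated space, the expected fibrewise
    divergence E_lam[KL(k_w || e_w)] is KL(lam (x) k || lam (x) e): a density of the
    joint laws restricts to a density on almost every fibre, and if the joint laws
    are not dominated the fibrewise divergence is infinite on a set of positive
    measure.

    By the Markov property law(X,C,Y) (x) P_{F|X,C} is the law of (X,C,Y,F), while
    law(X,C,Y) (x) P_{F|Y,C} is law(Y,C) (x) (P_{F|Y,C} x P_{X|Y,C}) up to a
    permutation of coordinates, so the predictive distortion is I(F;X|Y,C).

    If I(F;X|C) and I(F;Y|C) are finite, they are the expectations of log f and
    log g for densities f of P_{F|X,C} and g of P_{F|Y,C} with respect to P_{F|C};
    then f / g is a density of P_{F|X,C} with respect to P_{F|Y,C}, so the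
    distortion is E[log f] - E[log g]. *)

Set Implicit Arguments.
Unset Strict Implicit.
Unset Printing Implicit Defensive.

Import Order.TTheory GRing.Theory Num.Theory.

Local Open Scope classical_set_scope.
Local Open Scope ring_scope.
Local Open Scope ereal_scope.

(** * Joint laws of kernels *)

(* [pprobability T R] is the carrier of a generated sigma-algebra: this recovers
   the probability measure from a kernel value. *)
Definition law_at {R : realType} {dW dT : measure_display}
    {W : measurableType dW} {T : measurableType dT}
    (k : W -> pprobability T R) (w : W) : probability T R := k w.

Section kernels.
Context {R : realType} {dW dT : measure_display} {W : measurableType dW}
  {T : measurableType dT}.

(** The sigma-algebra on [pprobability T R] is generated by the sets of measures giving [A] mass
    below [r], so the evaluations at measurable sets decide measurability. *)
Lemma measurable_pprobability (k : W -> pprobability T R) :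
  (forall A, measurable A ->
     measurable_fun setT (fun w => law_at k w A)) ->
  measurable_fun setT k.
Proof.
move=> mk; apply: (@measurability _ _ _ _ setT k (@pset _ T R)) => //.
move=> _ [_ [r r01 [A mA <-]] <-]; rewrite setTI.
rewrite [X in measurable X](_ : _ =
  (fun w => law_at k w A) @^-1` `]-oo, r%:E[); last first.
  by apply/seteqP; split => w; rewrite /= in_itv.
rewrite -[X in measurable X]setTI; apply: mk => //; exact: emeasurable_itv.
Qed.

Variable k : {mfun W >-> pprobability T R}.

Definition kernel_of : R.-pker W ~> T := kprobability (measurable_funPT k).

Lemma measurable_kernel_eval (A : set T) : measurable A ->
  measurable_fun setT (fun w => law_at k w A).
Proof. exact: (measurable_kernel kernel_of). Qed.

Lemma measurable_kernel_integral (h : W * T -> \bar R) :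
  (forall z, 0 <= h z) -> measurable_fun setT h ->
  measurable_fun setT (fun w => \int[law_at k w]_t h (w, t)).
Proof. exact: (measurable_fun_integral_finite_kernel _ kernel_of). Qed.

Variable lam : probability W R.

(** This is delta_w x k_w. Binding it to [lam] in the Giry monad yields lam (x) k, so that [joint]
    is a measure and its integral formula comes from the monad and Tonelli. *)
Let dirac_kernel (w : W) : giry (W * T)%type R :=
  giry_prod (giry_ret w, law_at k w : giry T R).

Let measurable_dirac_kernel : measurable_fun setT dirac_kernel.
Proof.
apply: (@measurableT_comp _ _ _ _ _ _ giry_prod) => //.
  exact: measurable_giry_prod.
apply/measurable_fun_pair; first exact: measurable_giry_ret.
by apply: measurable_giry_codensity => // B; exact: measurable_kernel_eval.
Qed.

Definition joint : set (W * T) -> \bar R :=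
  giry_bind (lam : giry W R) measurable_dirac_kernel.

HB.instance Definition _ := Measure.on joint.

Lemma joint_integral (h : W * T -> \bar R) :
  (forall z, 0 <= h z) -> measurable_fun setT h ->
  \int[joint]_z h z = \int[lam]_w \int[law_at k w]_t h (w, t).
Proof.
move=> h0 mh; have -> : \int[joint]_z h z =
    giry_int (giry_bind (lam : giry W R) measurable_dirac_kernel) h by [].
rewrite giry_int_bind//; apply: eq_integral => w _.
rewrite giry_int_prod1// giry_int_ret//.
exact: measurable_fun_fubini_tonelli_F.
Qed.

Let joint_setT : joint setT = 1.
Proof.
have := integral_cst joint measurableT 1; rewrite mul1e => <-.
rewrite joint_integral//.
rewrite (eq_integral (cst 1)) => [|w _].
  by rewrite integral_cst// mul1e; exact: probability_setT.
by rewrite integral_cst// mul1e; exact: probability_setT.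
Qed.

HB.instance Definition _ := Measure_isProbability.Build _ _ _ joint joint_setT.

End kernels.

(** Change of variables is applied to the positive and negative parts separately, so no
    integrability is asked of [h]. Agreement of [mu] with the law of [V] on measurable sets
    suffices, which lets [mu] be a [joint]. *)
Lemma integral_law {R : realType} {dO dW : measure_display}
    {Om : measurableType dO} {W : measurableType dW} (P : probability Om R)
    (V : {mfun Om >-> W}) (mu : {measure set W -> \bar R}) (h : W -> \bar R) :
  (forall A, measurable A -> mu A = P (V @^-1` A)) ->
  measurable_fun setT h -> \int[mu]_x h x = \int[P]_w h (V w).
Proof.
move=> muE mh; rewrite (eq_measure_integral (distribution P V)); last first.
  by move=> A mA _; exact: muE.
rewrite [LHS]integralE [RHS]integralE.
rewrite (ge0_integral_pushforward (measurable_funPT V) P measurableT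
  (measurable_funepos mh))//.
by rewrite (ge0_integral_pushforward (measurable_funPT V) P measurableT
  (measurable_funeneg mh))// !preimage_setT -funepos_comp -funeneg_comp.
Qed.

Section joint_distribution.
Context {R : realType} {dO dW dT : measure_display} {Om : measurableType dO}
  {W : measurableType dW} {T : measurableType dT} (P : probability Om R)
  (V : {mfun Om >-> W}) (k : {mfun W >-> pprobability T R}).

Lemma joint_distribution_integral (h : W * T -> \bar R) :
  (forall z, 0 <= h z) -> measurable_fun setT h ->
  \int[joint k (distribution P V)]_z h z =
  \int[P]_w \int[law_at k (V w)]_t h (V w, t).
Proof.
move=> h0 mh; rewrite joint_integral//.
rewrite (integral_law (P := P) (V := V))//; exact: measurable_kernel_integral.
Qed.

End joint_distribution.

(** * Uniqueness of finite measures on products *)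

Lemma setI_closed_rectangles {d1 d2 : measure_display}
    {T1 : measurableType d1} {T2 : measurableType d2} :
  setI_closed [set A `*` B | A in @measurable _ T1 & B in @measurable _ T2].
Proof.
move=> _ _ [A1 mA1 [A2 mA2 <-]] [B1 mB1 [B2 mB2 <-]].
exists (A1 `&` B1); first exact: measurableI.
by exists (A2 `&` B2); [exact: measurableI|rewrite setXI].
Qed.

Lemma eq_measure_rectangles {R : realType} {d1 d2 : measure_display}
    {T1 : measurableType d1} {T2 : measurableType d2}
    (m1 m2 : {finite_measure set (T1 * T2)%type -> \bar R}) :
  (forall A B, measurable A -> measurable B ->
     m1 (A `*` B) = m2 (A `*` B)) ->
  forall D, measurable D -> m1 D = m2 D.
Proof.
move=> m12 D mD; have mT := @measurableT _ (T1 * T2)%type.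
apply: (measure_unique [set A `*` B | A in measurable & B in measurable]
  (fun=> setT)) => //.
- exact: measurable_prod_measurableType.
- exact: setI_closed_rectangles.
- by move=> _; exists setT => //; exists setT => //; rewrite setXTT.
- exact: bigcup_const.
- by move=> _ [A mA [B mB <-]]; exact: m12.
- by move=> _; rewrite -ge0_fin_numE// fin_num_measure.
Qed.

(** For fixed [C], the sets S on which the measures agree at S x C form a Dynkin system containing
    the rectangles; this reduces boxes to rectangles. Finiteness permits the subtraction in the
    complement case. *)
Lemma eq_measure_boxes {R : realType} {d1 d2 d3 : measure_display}
    {T1 : measurableType d1} {T2 : measurableType d2} {T3 : measurableType d3}
    (m1 m2 : {finite_measure set ((T1 * T2) * T3)%type -> \bar R}) :
  (forall A B C, measurable A -> measurable B -> measurable C ->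
     m1 ((A `*` B) `*` C) = m2 ((A `*` B) `*` C)) ->
  forall D, measurable D -> m1 D = m2 D.
Proof.
move=> m12; apply: eq_measure_rectangles => D C mD mC.
move: D mD; rewrite measurable_prod_measurableType.
apply: dynkin_induction => /=.
- exact: measurable_prod_measurableType.
- exact: setI_closed_rectangles.
- by rewrite -setXTT; exact: m12.
- by move=> _ [A mA [B mB <-]]; exact: m12.
- move=> S mS m12S; have mSC := measurableX mS mC.
  have mTC : measurable ([set: T1 * T2] `*` C) by exact: measurableX.
  have SCE : ~` S `*` C = ([set: T1 * T2] `*` C) `\` (S `*` C).
    apply/seteqP; split => [z [nSz Cz]|z [[_ Cz] nSCz]].
      by split => // -[].
    by split => //= Sz; exact: nSCz.
  have SCI : ([set: T1 * T2] `*` C) `&` (S `*` C) = S `*` C.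
    by rewrite -setXI setTI setIid.
  have mE (m : {finite_measure set ((T1 * T2) * T3)%type -> \bar R}) :
      m (~` S `*` C) = m ([set: T1 * T2] `*` C) - m (S `*` C).
    by rewrite SCE measureD// ?SCI// -ge0_fin_numE// fin_num_measure.
  by rewrite !mE m12S -setXTT m12.
- move=> F mF tF m12F; rewrite setX_bigcupl.
  have mFC n : measurable (F n `*` C) by exact: measurableX.
  have tFC : trivIset setT (fun n => F n `*` C).
    move=> i j _ _ [z [[Fi _] [Fj _]]].
    by apply: tF => //; exists z.1.
  rewrite !measure_semi_bigcup//; [|exact: bigcup_measurable..].
  by apply: eq_eseriesr => n _; exact: m12F.
Qed.

(** The generator is required to be a pi-system containing the whole space, the form in which Dynkin
    induction and the total-mass argument for densities use it. *)
Definition countably_generated {d : measure_display} (T : measurableType d) :=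
  exists G : (set T)^nat,
    [/\ setI_closed (range G), range G setT & measurable = <<s range G >>].

(** * Countably generated sigma-algebras *)

Section countably_generated.

Lemma countably_generated_countType {d : measure_display}
    {T : measurableType d} (I : countType) (G : I -> set T) :
  setI_closed (range G) -> range G setT -> measurable = <<s range G >> ->
  countably_generated T.
Proof.
move=> GI GT mG.
have rangeE : range (fun n => if unpickle n is Some i then G i else setT) =
    range G.
  apply/seteqP; split => [_ [n _ <-]|_ [i _ <-]].
    by case: unpickle => [i|//]; exists i.
  by exists (pickle i) => //; rewrite pickleK.
by exists (fun n => if unpickle n is Some i then G i else setT); rewrite rangeE.
Qed.

(** Finite intersections of the family, indexed by the countable type [seq nat], form the required
    pi-system; the empty sequence gives [setT]. *)
Lemma countably_generated_family {d : measure_display} {T : measurableType d}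
    (B : (set T)^nat) :
  measurable = <<s range B >> -> countably_generated T.
Proof.
move=> mB.
apply: (@countably_generated_countType _ _ (seq nat)
  (fun s : seq nat => \bigcap_(i in [set` s]) B i)).
- move=> _ _ [s _ <-] [t _ <-]; exists (s ++ t) => //.
  rewrite -bigcap_setU; congr (\bigcap_(i in _) B i).
  by apply/seteqP; split => i; rewrite /= mem_cat => /orP.
- by exists [::] => //; rewrite set_nil bigcap_set0.
- rewrite mB; apply/seteqP; split; apply: smallest_sub;
    try exact: smallest_sigma_algebra.
  + move=> _ [i _ <-]; apply: sub_sigma_algebra; exists [:: i] => //.
    rewrite (_ : [set` [:: i]] = [set i]) ?bigcap_set1//.
    by apply/seteqP; split => j /=; rewrite inE => /eqP.
  + move=> _ [s _ <-]; rewrite -mB; apply: fin_bigcap_measurable => // i _.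
    by rewrite mB; apply: sub_sigma_algebra; exists i.
Qed.

Lemma countably_generated_prod {d1 d2 : measure_display}
    {T1 : measurableType d1} {T2 : measurableType d2} :
  countably_generated T1 -> countably_generated T2 ->
  countably_generated (T1 * T2)%type.
Proof.
move=> [G1 [G1I G1T mG1]] [G2 [G2I G2T mG2]].
apply: (@countably_generated_countType _ _ (nat * nat)%type
  (fun n => G1 n.1 `*` G2 n.2)).
- move=> _ _ [i _ <-] [j _ <-]; rewrite -setXI.
  have [k1 _ <-] := G1I _ _ (imageT G1 i.1) (imageT G1 j.1).
  have [k2 _ <-] := G2I _ _ (imageT G2 i.2) (imageT G2 j.2).
  by exists (k1, k2).
- have [k1 _ k1E] := G1T; have [k2 _ k2E] := G2T.
  by exists (k1, k2) => //=; rewrite k1E k2E setXTT.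
- apply/seteqP; split; last first.
    apply: smallest_sub; first exact: sigma_algebra_measurable.
    move=> _ [k _ <-]; apply: measurableX.
      by rewrite mG1; apply: sub_sigma_algebra; exists k.1.
    by rewrite mG2; apply: sub_sigma_algebra; exists k.2.
  have [k1 _ k1E] := G1T; have [k2 _ k2E] := G2T.
  pose S := <<s range (fun n : nat * nat => G1 n.1 `*` G2 n.2) >>.
  have sS : sigma_algebra setT S by exact: smallest_sigma_algebra.
  apply: smallest_sub => //; rewrite subUset; split.
    move=> _ [A mA <-]; rewrite setTI.
    (* Good sets: those whose cylinder lies in [S] form a sigma-algebra. It contains [range G1]
       because [setT] is in [range G2], which makes each such cylinder one of the rectangles. *)
    suff : measurable `<=` [set A | S (fst @^-1` A)] by apply.
    rewrite mG1; apply: smallest_sub.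
      split.
      + by rewrite /= preimage_set0; case: sS.
      + move=> B SB; rewrite /= setTD preimage_setC -setTD.
        by case: sS => _ + _; exact.
      + move=> B SB; rewrite /= preimage_bigcup.
        by case: sS => _ _; exact.
    move=> _ [k _ <-]; apply: sub_sigma_algebra; exists (k, k2) => //=.
    by rewrite k2E setXT.
  move=> _ [A mA <-]; rewrite setTI.
  suff : measurable `<=` [set A | S (snd @^-1` A)] by apply.
  rewrite mG2; apply: smallest_sub.
    split.
    + by rewrite /= preimage_set0; case: sS.
    + move=> B SB; rewrite /= setTD preimage_setC -setTD.
      by case: sS => _ + _; exact.
    + move=> B SB; rewrite /= preimage_bigcup.
      by case: sS => _ _; exact.
  move=> _ [k _ <-]; apply: sub_sigma_algebra; exists (k1, k) => //=.
  by rewrite k1E setTX.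
Qed.

End countably_generated.

(** * Densities and relative entropy *)

(** Densities are real-valued and nonnegative everywhere, so that logarithms, inverses and quotients
    can be formed pointwise without an exceptional set. *)
Definition is_density {R : realType} {d : measure_display}
    {T : measurableType d} (mu : set T -> \bar R)
    (nu : {measure set T -> \bar R}) (f : T -> R) :=
  [/\ measurable_fun setT f, forall x, (0 <= f x)%R &
      forall A, measurable A -> mu A = \int[nu]_(x in A) (f x)%:E].

Lemma measurable_zeros {R : realType} {d : measure_display}
    {T : measurableType d} (f : T -> R) :
  measurable_fun setT f -> measurable [set x | f x = 0%R].
Proof.
move=> mf; rewrite -[X in measurable X]setTI.
exact: (mf measurableT _ (measurable_set1 0%R)).
Qed.

Lemma measurable_fun_ge0_inv {R : realType} {d : measure_display}
    {T : measurableType d} (f : T -> R) :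
  (forall x, (0 <= f x)%R) -> measurable_fun setT f ->
  measurable_fun setT (fun x => (f x)^-1)%R.
Proof.
move=> f0 mf; rewrite (_ : (fun _ => _) = (fun x => f x `^ (-1))%R).
  by apply: (measurableT_comp (measurable_powR (-1)%R)).
by apply/funext => x; rewrite powR_inv1.
Qed.

Section density.
Context {R : realType} {d : measure_display} {T : measurableType d}.
Implicit Types (mu : {finite_measure set T -> \bar R})
  (nu : {sigma_finite_measure set T -> \bar R}).

Lemma density_dominates mu nu f : is_density mu nu f -> mu `<< nu.
Proof.
move=> [mf f0 muE]; apply/null_content_dominatesP => A mA nuA.
rewrite muE// null_set_integral//.
by apply: measurable_funTS; exact/measurable_EFinP.
Qed.

Lemma density_exists mu nu : mu `<< nu -> exists f, is_density mu nu f.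
Proof.
move=> munu; have [f [f0 ffin intf fE]] := radon_nikodym_sigma_finite munu.
exists (fine \o f); split.
- by apply: measurableT_comp => //; exact: measurable_int intf.
- by move=> x; exact: fine_ge0.
- by move=> A mA; rewrite fE//; apply: eq_integral => x _; rewrite /= fineK.
Qed.

(** Change of variables holds for the Radon-Nikodym derivative, and [f] agrees with it [nu]-almost
    everywhere because both have the same integral over every measurable set. *)
Lemma density_integral mu nu f h : is_density mu nu f ->
  (forall x, 0 <= h x) -> measurable_fun setT h ->
  \int[mu]_x h x = \int[nu]_x (h x * (f x)%:E).
Proof.
move=> fmunu h0 mh; have munu := density_dominates fmunu.
have [mf f0 muE] := fmunu.
rewrite -(Radon_Nikodym_SigmaFinite.change_of_variables munu h0)//.
have mRN : measurable_fun setT (Radon_Nikodym_SigmaFinite.f mu nu).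
  exact: measurable_int (Radon_Nikodym_SigmaFinite.f_integrable munu).
apply: ge0_ae_eq_integral => //.
- exact: emeasurable_funM.
- by apply: emeasurable_funM => //; exact/measurable_EFinP.
- by move=> x _; rewrite mule_ge0// Radon_Nikodym_SigmaFinite.f_ge0.
- by move=> x _; rewrite mule_ge0// lee_fin.
have [N [mN N0 sN]] :
    ae_eq nu setT (Radon_Nikodym_SigmaFinite.f mu nu) (EFin \o f).
  apply: integral_ae_eq => //.
  + exact: Radon_Nikodym_SigmaFinite.f_integrable.
  + exact/measurable_EFinP.
  + by move=> E _ mE; rewrite -muE// -Radon_Nikodym_SigmaFinite.f_integral.
exists N; split => // x /= hx; apply: sN => /= fx; apply: hx => _.
by rewrite fx.
Qed.

Lemma density_integral_in mu nu f h A : is_density mu nu f ->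
  measurable A ->
  (forall x, 0 <= h x) -> measurable_fun setT h ->
  \int[mu]_(x in A) h x = \int[nu]_(x in A) (h x * (f x)%:E).
Proof.
move=> fmunu mA h0 mh.
rewrite integral_mkcond (density_integral fmunu)//; last 2 first.
- by move=> x; exact: erestrict_ge0.
- by apply/(measurable_restrictT _ _).1 => //; exact: measurable_funTS.
rewrite [RHS]integral_mkcond; apply: eq_integral => x _.
by rewrite !patchE; case: ifPn => // _; rewrite mul0e.
Qed.

Lemma density_eq0 mu nu f : is_density mu nu f -> mu [set x | f x = 0%R] = 0.
Proof.
move=> [mf f0 muE].
have mf0 : measurable [set x | f x = 0%R].
  exact: measurable_zeros.
by rewrite muE//; apply: integral0_eq => x /= ->.
Qed.

(** After the change of variables the integrand f^-1 f is 1 where f > 0 and 0 where f = 0, since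
    0^-1 = 0. This bounds the negative part of the log-density. *)
Lemma density_integralV mu (nu : probability T R) f : is_density mu nu f ->
  \int[mu]_x ((f x)^-1)%:E <= 1.
Proof.
move=> fmunu; have [mf f0 muE] := fmunu.
have mV : measurable_fun setT (fun x => (f x)^-1)%R.
  exact: measurable_fun_ge0_inv.
rewrite (density_integral fmunu)//; last 2 first.
- by move=> x; rewrite lee_fin invr_ge0.
- exact/measurable_EFinP.
rewrite -(probability_setT nu) -[leRHS]mul1e -integral_cst//.
apply: ge0_le_integral => //.
- by move=> x _; rewrite -EFinM lee_fin mulr_ge0// invr_ge0.
- by apply: emeasurable_funM; exact/measurable_EFinP.
- move=> x _; rewrite -EFinM lee_fin; have [->|fx] := eqVneq (f x) 0%R.
    by rewrite mulr0.
  by rewrite mulVf.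
Qed.

Lemma density_quotient mu (nu : {finite_measure set T -> \bar R})
    (rho : {sigma_finite_measure set T -> \bar R}) f g :
  is_density mu rho f -> is_density nu rho g ->
  mu [set x | g x = 0%R] = 0 -> is_density mu nu (fun x => f x / g x)%R.
Proof.
move=> [mf f0 fE] gdens mug0; have [mg g0 gE] := gdens.
have mV : measurable_fun setT (fun x => (g x)^-1)%R.
  exact: measurable_fun_ge0_inv.
have mq : measurable_fun setT (fun x => f x / g x)%R by exact: measurable_funM.
have q0 x : (0 <= f x / g x)%R by rewrite divr_ge0.
have mgZ : measurable [set x | g x = 0%R].
  exact: measurable_zeros.
split => // A mA.
rewrite (density_integral_in gdens)//; last exact/measurable_EFinP.
(* Off the zeros of [g] the product (f / g) g is [f]; on them it is 0, and they are [mu]-null by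
   hypothesis. *)
transitivity (mu (A `\` [set x | g x = 0%R])).
  rewrite (measureDI mu mA mgZ) [X in _ + X](_ : _ = 0) ?adde0//.
  apply/eqP; rewrite eq_le measure_ge0 andbT -[leRHS]mug0.
  by apply: le_measure => //; rewrite inE//; exact: measurableI.
rewrite fE; last exact: measurableD.
rewrite integral_mkcond [RHS]integral_mkcond; apply: eq_integral => x _.
rewrite !patchE; case: ifPn => [/set_mem[/mem_set -> /= gx]|].
  by rewrite -EFinM divfK//; exact/eqP.
case: ifPn => // xA xAg; rewrite -EFinM.
have [->|gx] := eqVneq (g x) 0%R; first by rewrite mulr0.
by case/negP: xAg; apply/mem_set; split; [exact/set_mem|exact/eqP].
Qed.

End density.

Section relative_entropy.
Context {R : realType} (b : R) (b_gt1 : (1 < b)%R).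

Definition logb (x : R) : R := (ln x / ln b)%R.

Lemma measurable_logb {d : measure_display} {T : measurableType d}
  (f : T -> R) : measurable_fun setT f ->
  measurable_fun setT (fun x => (logb (f x))%:E).
Proof.
move=> mf; apply/measurable_EFinP; apply: measurable_funM => //.
exact: measurableT_comp.
Qed.

Lemma lnb_gt0 : (0 < ln b)%R. Proof. exact: ln_gt0. Qed.

(** For x > 0 this is ln (1/x) < 1/x. At x = 0 both sides are 0 under the conventions for [ln] and
    the inverse. *)
Lemma logb_funeneg_le (x : R) : (0 <= x)%R ->
  maxe (- (logb x)%:E) 0 <= ((ln b)^-1 * x^-1)%:E.
Proof.
move=> x0; have lnb := lnb_gt0.
rewrite ge_max !lee_fin mulr_ge0 ?invr_ge0 ?(ltW lnb)// andbT.
rewrite /logb -mulNr mulrC ler_pM2l ?invr_gt0//.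
have [->|xn0] := eqVneq x 0%R; first by rewrite ln0// oppr0 invr0.
have xp : (0 < x)%R by rewrite lt_def xn0.
by rewrite -lnV ?posrE// ltW// ln_sublinear// invr_gt0.
Qed.

Section kl.
Context {d : measure_display} {T : measurableType d}.
Implicit Types mu nu : probability T R.

(** Two densities agree [nu]-almost everywhere, hence [mu]-almost everywhere by domination, so any
    density computes the divergence. *)
Lemma klE mu nu f : is_density mu nu f ->
  kl b mu nu = \int[mu]_x (logb (f x))%:E.
Proof.
move=> fmunu; have munu := density_dominates fmunu.
have [mf f0 muE] := fmunu.
rewrite /kl asboolT//.
set g := Radon_Nikodym _ _.
have mg : measurable_fun setT g.
  by apply: measurable_int; exact: Radon_Nikodym_integrable.
apply: ae_eq_integral => //.
- by apply: measurable_logb; exact: measurableT_comp.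
- exact: measurable_logb.
have : ae_eq nu setT g (EFin \o f).
  apply: integral_ae_eq => //.
  + exact: Radon_Nikodym_integrable.
  + exact/measurable_EFinP.
  + by move=> E _ mE; rewrite -muE// -Radon_Nikodym_integral.
move=> /(null_dominates_ae_eq measurableT munu) [N [mN N0 sN]].
exists N; split => // x /= hx; apply: sN => /= gx; apply: hx => _.
by rewrite gx.
Qed.

Lemma kl_notdominated mu nu : ~ mu `<< nu -> kl b mu nu = +oo.
Proof. by move=> munu; rewrite /kl asboolF. Qed.

Lemma density_logb_funeneg mu nu f : is_density mu nu f ->
  \int[mu]_x (maxe (- (logb (f x))%:E) 0) <= (ln b)^-1%:E.
Proof.
move=> fmunu; have [mf f0 muE] := fmunu; have lnb := lnb_gt0.
have mV : measurable_fun setT (fun x => (f x)^-1)%R.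
  exact: measurable_fun_ge0_inv.
apply: (@le_trans _ _ (\int[mu]_x ((ln b)^-1%:E * ((f x)^-1)%:E))).
  apply: ge0_le_integral => //.
  - by move=> x _; rewrite le_max lexx orbT.
  - apply: measurable_maxe => //; apply: measurableT_comp => //.
    exact: measurable_logb.
  - by apply: emeasurable_funM => //; exact/measurable_EFinP.
  - by move=> x _; rewrite -EFinM; exact: logb_funeneg_le.
rewrite ge0_integralZl//.
- rewrite -[leRHS]mule1 lee_pmul2l ?lte_fin ?invr_gt0//.
  exact: density_integralV fmunu.
- exact/measurable_EFinP.
- by move=> x _; rewrite lee_fin invr_ge0.
- by rewrite lee_fin invr_ge0 ltW.
Qed.

(** Gibbs' inequality. The integral of the negative part is finite, so it is enough to compare it
    with that of the positive part. *)
Lemma kl_ge0 mu nu : 0 <= kl b mu nu.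
Proof.
have [munu|/kl_notdominated ->//] := pselect (mu `<< nu).
have [f fmunu] := density_exists munu; rewrite (klE fmunu).
have [mf f0 muE] := fmunu; have lnb := lnb_gt0.
have mV : measurable_fun setT (fun x => (f x)^-1)%R.
  exact: measurable_fun_ge0_inv.
have mL := measurable_logb mf.
set h := fun x => (logb (f x))%:E.
have negfin : \int[mu]_x h^\- x \is a fin_num.
  rewrite ge0_fin_numE; last exact: integral_ge0.
  apply: le_lt_trans (ltry (ln b)^-1).
  rewrite (eq_integral (fun x => maxe (- (logb (f x))%:E) 0)).
    exact: density_logb_funeneg fmunu.
  by move=> x _; rewrite funenegE.
rewrite integralE sube_ge0; last by rewrite negfin.
have mf0 : measurable [set x | f x = 0%R].
  exact: measurable_zeros.
pose c := (ln b)^-1%:E.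
have c0 : 0 <= c by rewrite lee_fin invr_ge0 ltW.
have pos1 : \int[mu]_x (\1_(~` [set x | f x = 0%R]) x)%:E = 1.
  rewrite integral_indic ?setIT//; last exact: measurableC.
  rewrite -[LHS]/(mu (~` [set x | f x = 0%R])) probability_setC//.
  by rewrite (density_eq0 fmunu) sube0.
have mI : measurable_fun setT (fun x => (\1_(~` [set x | f x = 0%R]) x)%:E : \bar R).
  by apply/measurable_EFinP; apply: measurable_indic; exact: measurableC.
have mV' : measurable_fun setT (fun x => ((f x)^-1)%:E : \bar R).
  exact/measurable_EFinP.
have V0 x : (0 : \bar R) <= ((f x)^-1)%:E by rewrite lee_fin invr_ge0.
(* The left [c] will be c times mu(f <> 0) = 1, and the right one bounds c times the integral of
   1/f. *)
suff : c + \int[mu]_x h^\- x <= \int[mu]_x h^\+ x + c.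
  by rewrite (addeC c) leeD2rE.
(* ln y >= 1 - 1/y for y > 0, with signs arranged so that both sides are
   nonnegative; the indicator accounts for the junk values at y = 0. *)
apply: (@le_trans _ _
  (\int[mu]_x (c * (\1_(~` [set x | f x = 0%R]) x)%:E + h^\- x))).
  rewrite ge0_integralD//; last 3 first.
  - by move=> x _; rewrite mule_ge0// lee_fin.
  - exact: emeasurable_funM.
  - exact: measurable_funeneg.
  by rewrite ge0_integralZl// pos1 mule1.
apply: (@le_trans _ _ (\int[mu]_x (h^\+ x + c * ((f x)^-1)%:E))); last first.
  rewrite ge0_integralD//; last 3 first.
  - exact: measurable_funepos.
  - by move=> x _; rewrite mule_ge0.
  - exact: emeasurable_funM.
  rewrite leeD2l// ge0_integralZl// -[leRHS]mule1 lee_wpmul2l//.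
  exact: density_integralV fmunu.
apply: ge0_le_integral => //.
- by move=> x _; rewrite adde_ge0// mule_ge0// lee_fin.
- by apply: emeasurable_funD; [exact: emeasurable_funM|exact: measurable_funeneg].
- by apply: emeasurable_funD; [exact: measurable_funepos|exact: emeasurable_funM].
move=> x _; rewrite funeposE funenegE /h -EFinN -!EFin_max -!EFinM -!EFinD lee_fin.
rewrite addrC -lerBrDr -addrA -lerBlDl.
have -> : (Num.max (- logb (f x)) 0 - Num.max (logb (f x)) 0 = - logb (f x))%R.
  have [L0|/ltW L0] := leP 0%R (logb (f x)).
    by rewrite max_r ?oppr_le0// sub0r.
  by rewrite max_l ?oppr_ge0// subr0.
rewrite -mulrBr /logb -mulNr mulrC ler_pM2l ?invr_gt0//.
rewrite indicE; have [fx0|fxn0] := eqVneq (f x) 0%R.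
  by rewrite memNset//= fx0 ln0// oppr0 invr0 addr0.
rewrite mem_set/=; last exact/eqP.
have fp : (0 < f x)%R by rewrite lt_def fxn0 f0.
have Vp : (0 < (f x)^-1)%R by rewrite invr_gt0.
rewrite -lnV ?posrE//.
have := @le_ln1Dx R ((f x)^-1 - 1); rewrite (addrC 1%R) subrK; apply.
by lra.
Qed.

End kl.
End relative_entropy.

(** * Disintegration of densities *)

Section nonmeasurable_integrand.
Context {R : realType} {d : measure_display} {T : measurableType d}
  (mu : {measure set T -> \bar R}).
Implicit Types f g : T -> \bar R.

(** The integral of a nonnegative function is a supremum over the simple functions below it, which
    is monotone whether or not the function is measurable. *)
Lemma ge0_le_integral_nonmeasurable f g :
  (forall x, 0 <= f x) -> (forall x, f x <= g x) ->
  \int[mu]_x f x <= \int[mu]_x g x.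
Proof.
move=> f0 fg; have g0 x : 0 <= g x by exact: le_trans (fg x).
rewrite !ge0_integralTE//; apply: ereal_sup_le => _ [h hf <-].
by exists h => // x; exact: le_trans (fg x).
Qed.

(** With N the null set, [f] lies between [g] cut to 0 on N and [g] raised to +oo on N. Both bounds
    are measurable and have the integral of [g]. *)
Lemma ge0_ae_eq_integral_nonmeasurable f g :
  (forall x, 0 <= f x) -> (forall x, 0 <= g x) -> measurable_fun setT g ->
  (\forall x \ae mu, f x = g x) -> \int[mu]_x f x = \int[mu]_x g x.
Proof.
move=> f0 g0 mg [N [mN muN0 sN]].
have fgN x : ~ N x -> f x = g x.
  by move=> Nx; apply/not_notP => fgx; apply: Nx; exact: sN.
have mgN : measurable_fun setT (g \_ (~` N)).
  apply/(measurable_restrictT _ _).1; first exact: measurableC.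
  exact: measurable_funTS.
have moo : measurable_fun setT ((cst +oo : T -> \bar R) \_ N).
  by apply/(measurable_restrictT _ _).1.
apply/eqP; rewrite eq_le; apply/andP; split.
- have -> : \int[mu]_x g x = \int[mu]_x (g x + ((cst +oo) \_ N) x).
    apply: ge0_ae_eq_integral => //.
    + exact: emeasurable_funD.
    + move=> x _; apply: adde_ge0 => //; apply: erestrict_ge0 => y _; exact: leey.
    exists N; split => // x /= hx; apply/not_notP => Nx; apply: hx => _.
    by rewrite patchE memNset// adde0.
  apply: ge0_le_integral_nonmeasurable => // x.
  rewrite patchE; case: ifPn => [_|/negP Nx]; last first.
    by rewrite adde0 fgN// => /mem_set.
  by rewrite addey ?leey// gt_eqF// (lt_le_trans _ (g0 x)).
- have -> : \int[mu]_x g x = \int[mu]_x (g \_ (~` N)) x.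
    apply: ge0_ae_eq_integral => //.
    + by move=> x _; exact: erestrict_ge0.
    exists N; split => // x /= hx; apply/not_notP => Nx; apply: hx => _.
    by rewrite patchE mem_set.
  apply: ge0_le_integral_nonmeasurable => x; first exact: erestrict_ge0.
  by rewrite patchE; case: ifPn => [/set_mem/fgN ->|_].
Qed.

End nonmeasurable_integrand.

Lemma ae_distribution {R : realType} {dO dW : measure_display}
    {Om : measurableType dO} {W : measurableType dW} (P : probability Om R)
    (V : {mfun Om >-> W}) (Q : W -> Prop) :
  (\forall w \ae distribution P V, Q w) -> \forall x \ae P, Q (V x).
Proof.
move=> [N [mN N0 sN]]; exists (V @^-1` N); split => //.
- by rewrite -[X in measurable X]setTI; exact: measurable_funPT.
- by move=> x /= Qx; exact: sN.
Qed.

Section joint_rectangle.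
Context {R : realType} {dW dT : measure_display} {W : measurableType dW}
  {T : measurableType dT} (k : {mfun W >-> pprobability T R})
  (lam : probability W R).

Lemma joint_integral_setX (h : W * T -> \bar R) (A : set W) (B : set T) :
  measurable A -> measurable B ->
  (forall z, 0 <= h z) -> measurable_fun setT h ->
  \int[joint k lam]_(z in A `*` B) h z =
  \int[lam]_(w in A) \int[law_at k w]_(t in B) h (w, t).
Proof.
move=> mA mB h0 mh; rewrite integral_mkcond joint_integral.
- rewrite [RHS]integral_mkcond; apply: eq_integral => w _.
  rewrite [RHS]patchE; case: ifPn => wA.
    rewrite [RHS]integral_mkcond; apply: eq_integral => t _.
    by rewrite !patchE in_setX/= wA.
  rewrite integral0_eq// => t _.
  by rewrite patchE in_setX/= (negbTE wA).
- by move=> z; exact: erestrict_ge0.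
- apply/(measurable_restrictT _ _).1; first exact: measurableX.
  exact: measurable_funTS.
Qed.

Lemma joint_setX (A : set W) (B : set T) : measurable A -> measurable B ->
  joint k lam (A `*` B) = \int[lam]_(w in A) law_at k w B.
Proof.
move=> mA mB; have mAB : measurable (A `*` B) by exact: measurableX.
have := integral_cst (joint k lam) mAB 1; rewrite mul1e => <-.
rewrite joint_integral_setX//; apply: eq_integral => w _.
by rewrite integral_cst// mul1e.
Qed.

Lemma jointE (A : set (W * T)) : measurable A ->
  joint k lam A = \int[lam]_w law_at k w (xsection A w).
Proof.
move=> mA.
have -> : joint k lam A = \int[joint k lam]_z (\1_A z)%:E.
  by rewrite integral_indic// setIT.
rewrite joint_integral//.
- apply: eq_integral => w _.
  rewrite -[in RHS](setIT (xsection A w)) -integral_indic//; last first.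
    exact: measurable_xsection.
  by apply: eq_integral => t _; rewrite !indicE mem_xsection.
- by apply/measurable_EFinP; exact: measurable_indic.
Qed.

End joint_rectangle.

Section disintegration.
Context {R : realType} {dW dT : measure_display} {W : measurableType dW}
  {T : measurableType dT}.

Lemma density_of_generator (mu nu : probability T R) (f : T -> R)
    (G : set (set T)) :
  measurable = <<s G >> -> setI_closed G -> G setT ->
  measurable_fun setT f -> (forall x, (0 <= f x)%R) ->
  (forall A, G A -> mu A = \int[nu]_(x in A) (f x)%:E) ->
  is_density mu nu f.
Proof.
move=> mG GI GT mf f0 muG; split => // A.
have mfE : measurable_fun setT (EFin \o f) by exact/measurable_EFinP.
rewrite [in X in X -> _]mG; move: A; apply: dynkin_induction => //.
- exact: muG.
- move=> S mS muS; have mCS : measurable (~` S) by exact: measurableC.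
  (* [G] contains the whole space, so [f] has total integral 1; the complement case then follows by
     subtraction. *)
  have : \int[nu]_(x in S `|` ~` S) (f x)%:E = 1.
    by rewrite setUv -muG// probability_setT.
  rewrite ge0_integral_setU//; last 3 first.
  - exact: measurable_funTS.
  - by move=> x _; rewrite lee_fin.
  - by apply/disj_setPCl.
  rewrite -muS probability_setC// => <-.
  by rewrite addeAC subee ?add0e// fin_num_measure.
- move=> F mF tF muF; rewrite measure_semi_bigcup//; last exact: bigcup_measurable.
  rewrite ge0_integral_bigcup//.
  + by apply: eq_eseriesr => n _; exact: muF.
  + exact: measurable_funTS.
  + by move=> x _; rewrite lee_fin.
Qed.

(* A density of the joint laws is a density of almost every pair of fibres: this
   is an almost sure statement for each event of a countable generating
   pi-system, hence for all of them at once. *)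
Lemma density_disintegration (lam : probability W R)
    (k e : {mfun W >-> pprobability T R}) (f : W * T -> R) :
  countably_generated T ->
  is_density (joint k lam) (joint e lam) f ->
  \forall w \ae lam, is_density (law_at k w) (law_at e w) (fun t => f (w, t)).
Proof.
move=> [G [GI GT mG]] [mf f0 fE].
have mfE : measurable_fun setT (EFin \o f) by exact/measurable_EFinP.
have mGn n : measurable (G n) by rewrite mG; apply: sub_sigma_algebra; exists n.
have mint n : measurable_fun setT
    (fun w => \int[law_at e w]_(t in G n) (f (w, t))%:E).
  rewrite [X in measurable_fun _ X](_ : _ = (fun w =>
    \int[law_at e w]_t ((EFin \o f) \_ (setT `*` G n)) (w, t))); last first.
    apply/funext => w; rewrite integral_mkcond; apply: eq_integral => t _.
    by rewrite !patchE in_setX/= in_setT.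
  apply: measurable_kernel_integral => [z|].
    by apply: erestrict_ge0 => x _; rewrite lee_fin.
  apply/(measurable_restrictT _ _).1; first exact: measurableX.
  exact: measurable_funTS.
have aeG n : \forall w \ae lam, law_at k w (G n) =
    \int[law_at e w]_(t in G n) (f (w, t))%:E.
  have [N [mN N0 sN]] : ae_eq lam setT (fun w => law_at k w (G n))
      (fun w => \int[law_at e w]_(t in G n) (f (w, t))%:E).
    apply: integral_ae_eq => //.
    (* Almost sure equality follows from equal integrals over every measurable E, which is the joint
       density identity on E x G n. The integrability required of one side comes from k_w(G n) <=
       1. *)
    - apply/integrableP; split; first exact: measurable_kernel_eval.
      apply: (@le_lt_trans _ _ (\int[lam]_w cst 1 w)); last first.
        by rewrite integral_cst// mul1e -ge0_fin_numE// fin_num_measure.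
      apply: ge0_le_integral => //.
        by apply: measurableT_comp => //; exact: measurable_kernel_eval.
      by move=> w _; rewrite gee0_abs//; exact: probability_le1.
    - move=> E _ mE; rewrite -joint_setX// fE; last exact: measurableX.
      by rewrite (@joint_integral_setX _ _ _ _ _ e lam (EFin \o f)).
  by exists N; split => // w /= hw; apply: sN => /= /(_ I).
have [N [mN N0 sN]] := ae_foralln aeG.
exists N; split => // w /= hw; apply: sN => /= kw; apply: hw.
apply: (density_of_generator mG GI GT) => //.
- exact: (measurableT_comp mf).
- by move=> _ [n _ <-].
Qed.

(** Converse of [density_disintegration]: the fibre identity at the section of [A] is integrated
    over the base. *)
Lemma density_joint {dO : measure_display} {Om : measurableType dO}
    (P : probability Om R) (V : {mfun Om >-> W})
    (k e : {mfun W >-> pprobability T R}) (f : W * T -> R) :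
  measurable_fun setT f -> (forall z, (0 <= f z)%R) ->
  (\forall x \ae P, is_density (law_at k (V x)) (law_at e (V x))
     (fun t => f (V x, t))) ->
  is_density (joint k (distribution P V)) (joint e (distribution P V)) f.
Proof.
move=> mf f0 aef; split => // A mA.
have mfA : measurable_fun setT ((EFin \o f) \_ A).
  apply/(measurable_restrictT _ _).1 => //; apply: measurable_funTS.
  exact/measurable_EFinP.
have fA0 z : 0 <= ((EFin \o f) \_ A) z.
  by apply: erestrict_ge0 => ? _; rewrite lee_fin.
have mkA : measurable_fun setT (fun w => law_at k w (xsection A w)).
  exact: (measurable_fun_xsection_finite_kernel (kernel_of k) (mem_set mA)).
rewrite jointE// integral_mkcond joint_integral//.
rewrite !(@integral_law _ _ _ _ _ P V)//; last exact: measurable_kernel_integral.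
apply: ge0_ae_eq_integral => //.
- exact: (measurableT_comp mkA).
- exact: (measurableT_comp (measurable_kernel_integral e fA0 mfA)).
- by move=> w _; exact: integral_ge0.
have [N [mN N0 sN]] := aef.
exists N; split => // w /= hw; apply: sN => /= -[_ _ kE]; apply: hw => _.
rewrite kE; last exact: measurable_xsection.
rewrite integral_mkcond; apply: eq_integral => t _.
by rewrite !patchE mem_xsection.
Qed.

End disintegration.

(** * Relative entropy of joint laws *)

Section kl_joint.
Context {R : realType} (b : R) (b_gt1 : (1 < b)%R).
Context {dO dW dT : measure_display} {Om : measurableType dO}
  {W : measurableType dW} {T : measurableType dT} (P : probability Om R)
  (V : {mfun Om >-> W}) (k e : {mfun W >-> pprobability T R}).
Let lam : probability W R := distribution P V.

(** Some [A] is null for lam (x) e but not for lam (x) k. Almost every section is then null for [e],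
    while a set of fibres of positive measure has sections charged by [k]; on those fibres the
    divergence is +oo. *)
Let kl_joint_notdominated : ~ joint k lam `<< joint e lam ->
  \int[P]_x kl b (law_at k (V x)) (law_at e (V x)) = +oo.
Proof.
move=> /null_content_dominatesP/existsNP[A] /not_implyP[mA] /not_implyP[].
rewrite -[X in X = _]/(joint e lam A) -[X in ~ X = _]/(joint k lam A) => eA kA.
have mxs (l : {mfun W >-> pprobability T R}) :
    measurable_fun setT (fun w => law_at l w (xsection A w)).
  exact: (measurable_fun_xsection_finite_kernel (kernel_of l) (mem_set mA)).
have [N [mN N0 sN]] : ae_eq lam setT (fun w => law_at e w (xsection A w)) (cst 0).
  apply/ae_eq_integral_abs => //; rewrite -[RHS]eA jointE//.
  by apply: eq_integral => w _; rewrite gee0_abs.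
(* [g] takes only the values 0 and +oo: off a null set it is a measurable lower bound for the
   fibrewise divergence. *)
pose g w := +oo * law_at k w (xsection A w).
have mg : measurable_fun setT g by exact: measurable_funeM.
have g0 w : 0 <= g w by rewrite mule_ge0.
have intg : \int[lam]_w g w = +oo.
  rewrite ge0_integralZl// -jointE// gt0_mulye// lt0e measure_ge0 andbT.
  exact/eqP.
have mgN : measurable_fun setT (g \_ (~` N)).
  apply/(measurable_restrictT _ _).1; first exact: measurableC.
  exact: measurable_funTS.
have : \int[lam]_w (g \_ (~` N)) w = +oo.
  rewrite -[RHS]intg; apply: ge0_ae_eq_integral => //.
    by move=> w _; exact: erestrict_ge0.
  exists N; split => // w /= hw; apply/not_notP => Nw; apply: hw => _.
  by rewrite patchE mem_set.
rewrite (@integral_law _ _ _ _ _ P V)// => gNoo.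
apply/eqP; rewrite -leye_eq -[leLHS]gNoo.
apply: ge0_le_integral_nonmeasurable => x; first exact: erestrict_ge0.
rewrite patchE; case: ifPn => [/set_mem Nx|_]; last exact: kl_ge0.
have [kx|kx] := eqVneq (law_at k (V x) (xsection A (V x))) 0.
  by rewrite /g kx mule0 kl_ge0.
rewrite kl_notdominated ?leey// => /null_content_dominatesP kex.
move/eqP: kx; apply; apply: kex; first exact: measurable_xsection.
by apply/not_notP => ex; apply: Nx; apply: sN => /= /(_ I).
Qed.

(* The fibrewise relative entropy is not known to be measurable; it agrees almost
   everywhere with a measurable function, or is infinite on a large set. *)
Lemma kl_joint : countably_generated T ->
  \int[P]_x kl b (law_at k (V x)) (law_at e (V x)) =
  kl b (joint k lam) (joint e lam).
Proof.
move=> cgT.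
have [kejoint|nkejoint] := pselect (joint k lam `<< joint e lam); last first.
  by rewrite kl_notdominated// kl_joint_notdominated.
have [f fdens] := density_exists kejoint.
have [mf f0 _] := fdens.
pose H z := (logb b (f z))%:E.
have mH : measurable_fun setT H by exact: measurable_logb.
have mHp : measurable_fun setT H^\+ by exact: measurable_funepos.
have mHn : measurable_fun setT H^\- by exact: measurable_funeneg.
pose gp w := \int[law_at k w]_t H^\+ (w, t).
pose gn w := \int[law_at k w]_t H^\- (w, t).
have gp0 w : 0 <= gp w by exact: integral_ge0.
have gn0 w : 0 <= gn w by exact: integral_ge0.
have mgp : measurable_fun setT gp by exact: measurable_kernel_integral.
have mgn : measurable_fun setT gn by exact: measurable_kernel_integral.
have gn_fin : \int[lam]_w gn w \is a fin_num.
  rewrite ge0_fin_numE; last exact: integral_ge0.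
  rewrite -joint_integral//; apply: le_lt_trans (ltry (ln b)^-1).
  rewrite (eq_integral (fun z => maxe (- (logb b (f z))%:E) 0)).
    exact: density_logb_funeneg fdens.
  by move=> z _; rewrite funenegE.
(* The truncation makes [u] nonnegative everywhere; on almost every fibre it changes nothing, since
   the difference there is a divergence. The relation u + gn = gp avoids subtracting possibly
   infinite quantities under the integral. *)
pose u w := maxe (gp w - gn w) 0.
have u0 w : 0 <= u w by rewrite le_max lexx orbT.
have mu : measurable_fun setT u.
  by apply: measurable_maxe => //; exact: emeasurable_funB.
have aeu : \forall w \ae lam,
    kl b (law_at k w) (law_at e w) = u w /\ u w + gn w = gp w.
  have [N [mN N0 sN]] := density_disintegration cgT fdens.
  exists N; split => // w /= hw; apply: sN => /= wdens; apply: hw.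
  have gnw : gn w \is a fin_num.
    rewrite ge0_fin_numE//; apply: le_lt_trans (ltry (ln b)^-1).
    apply: le_trans (density_logb_funeneg b_gt1 wdens).
    by rewrite le_eqVlt; apply/orP; left; apply/eqP; apply: eq_integral => t _;
      rewrite funenegE.
  have klw : kl b (law_at k w) (law_at e w) = gp w - gn w.
    rewrite (klE _ wdens) integralE; congr (_ - _); apply: eq_integral => t _.
      by rewrite !funeposE.
    by rewrite !funenegE.
  have uw : u w = gp w - gn w.
    by rewrite /u max_l// -klw kl_ge0.
  by rewrite klw uw subeK.
have -> : \int[P]_x kl b (law_at k (V x)) (law_at e (V x)) = \int[lam]_w u w.
  rewrite (@integral_law _ _ _ _ _ P V)//.
  apply: ge0_ae_eq_integral_nonmeasurable => //.
  - by move=> x; exact: kl_ge0.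
  - exact: measurableT_comp.
  apply: (@ae_distribution _ _ _ _ _ P V
    (fun w => kl b (law_at k w) (law_at e w) = u w)).
  have [N [mN N0 sN]] := aeu.
  by exists N; split => // w /= hw; apply: sN => /= -[].
transitivity (\int[joint k lam]_z H^\+ z - \int[joint k lam]_z H^\- z); last first.
  by rewrite (klE _ fdens) [RHS]integralE.
have -> : \int[joint k lam]_z H^\+ z = \int[lam]_w u w + \int[lam]_w gn w.
  rewrite joint_integral// -ge0_integralD//; apply: ge0_ae_eq_integral => //.
  - exact: emeasurable_funD.
  - by move=> w _; exact: gp0.
  - by move=> w _; exact: adde_ge0.
  have [N [mN N0 sN]] := aeu.
  exists N; split => // w /= hw; apply: sN => /= -[_ ugn]; apply: hw => _; exact/esym/ugn.
by rewrite joint_integral// addeK.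
Qed.

End kl_joint.

(** The measurable left inverse [psi] makes every measurable set of [T] a preimage under [phi], so a
    density [f] of the images pulls back to the density [f \o phi]. *)
Lemma kl_isomorphism {R : realType} (b : R) {d d' : measure_display}
    {T : measurableType d} {T' : measurableType d'} (phi : {mfun T >-> T'})
    (psi : T' -> T) (mu nu : probability T R) (mu' nu' : probability T' R) :
  measurable_fun setT psi -> cancel phi psi ->
  (forall A, measurable A -> mu' A = mu (phi @^-1` A)) ->
  (forall A, measurable A -> nu' A = nu (phi @^-1` A)) ->
  kl b mu' nu' = kl b mu nu.
Proof.
move=> mpsi phiK muE nuE.
have mphi A : measurable A -> measurable (phi @^-1` A).
  by move=> mA; rewrite -[X in measurable X]setTI; exact: measurable_funPT.
have [mn|nmn] := pselect (mu' `<< nu'); last first.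
  rewrite !kl_notdominated// => /null_content_dominatesP mn; apply: nmn.
  apply/null_content_dominatesP => A mA nuA.
  have nuphiA : nu (phi @^-1` A) = 0 by rewrite -nuE.
  by have muphiA : mu (phi @^-1` A) = 0 := mn _ (mphi _ mA) nuphiA; rewrite muE.
have [f fdens] := density_exists mn; have [mf f0 fE] := fdens.
have mfphi : measurable_fun setT (f \o phi) by exact: measurableT_comp.
have fphi : is_density mu nu (f \o phi).
  split => [//|x|A mA]; first exact: f0.
  have mpA : measurable (psi @^-1` A).
    by rewrite -[X in measurable X]setTI; exact: mpsi.
  have AE : A = phi @^-1` (psi @^-1` A).
    by apply/seteqP; split => x /=; rewrite phiK.
  rewrite [in LHS]AE -muE// fE// integral_mkcond.
  rewrite (@integral_law _ _ _ _ _ nu phi)//; last first.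
    apply/(measurable_restrictT _ _).1 => //; apply: measurable_funTS.
    exact/measurable_EFinP.
  rewrite [RHS]integral_mkcond; apply: eq_integral => x _.
  rewrite !patchE; congr (if _ then _ else _).
  by apply/idP/idP => /set_mem xA; apply/mem_set; move: xA; rewrite /= phiK.
rewrite (klE _ fdens) (klE _ fphi) (@integral_law _ _ _ _ _ mu phi)//.
exact: measurable_logb.
Qed.

(** * Conditional laws *)

Definition mfun_of {d d' : measure_display} {T : measurableType d}
    {T' : measurableType d'} (f : T -> T') (mf : measurable_fun setT f) :
    {mfun T >-> T'} :=
  HB.pack f (isMeasurableFun.Build _ _ _ _ f mf).

Section kernel_operations.
Context {R : realType} {dW dT : measure_display} {W : measurableType dW}
  {T : measurableType dT}.

Definition kernel_comp (k : {mfun W >-> pprobability T R})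
    {d : measure_display} {W' : measurableType d} (f : W' -> W)
    (mf : measurable_fun setT f) : {mfun W' >-> pprobability T R} :=
  mfun_of (measurableT_comp (measurable_funPT k) mf).

Lemma measurable_kernel_prod {d' : measure_display} {T' : measurableType d'}
    (k : {mfun W >-> pprobability T R})
    (k' : {mfun W >-> pprobability T' R}) :
  measurable_fun setT
    (fun w => (law_at k w \x law_at k' w : probability _ _)
      : pprobability (T * T')%type R).
Proof.
apply: measurable_pprobability => A mA.
have mk (d : measure_display) (U : measurableType d)
    (l : {mfun W >-> pprobability U R}) :
    measurable_fun setT (fun w => (law_at l w : giry U R)).
  by apply: measurable_giry_codensity => // B; exact: measurable_kernel_eval.
have mp : measurable_fun setT (fun w => giry_prod
    ((law_at k w : giry T R), (law_at k' w : giry T' R))).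
  apply: (@measurableT_comp _ _ _ _ _ _ giry_prod).
    exact: measurable_giry_prod.
  by apply/measurable_fun_pair; exact: mk.
exact: (measurableT_comp (measurable_giry_ev mA) mp).
Qed.

Definition kernel_prod {d' : measure_display} {T' : measurableType d'}
    (k : {mfun W >-> pprobability T R})
    (k' : {mfun W >-> pprobability T' R}) :
    {mfun W >-> pprobability (T * T')%type R} :=
  mfun_of (measurable_kernel_prod k k').

End kernel_operations.

Section conditional_law.
Context {R : realType} {dO dU dW : measure_display}
  {Om : measurableType dO} {TU : measurableType dU}
  {TW : measurableType dW} (P : probability Om R) (U : {mfun Om >-> TU})
  (W : {mfun Om >-> TW}).

Lemma rcd_joint (k : rcd P U W) (D : set (TW * TU)) : measurable D ->
  joint (rcd_kernel k) (distribution P W) D = P (rpair W U @^-1` D).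
Proof.
move: D.
apply: (@eq_measure_rectangles _ _ _ _ _ (joint (rcd_kernel k) (distribution P W))
  (distribution P (rpair W U))) => B A mB mA.
rewrite -[LHS]/(joint (rcd_kernel k) (distribution P W) (B `*` A)) joint_setX//.
rewrite -[LHS](rcd_disintegration k mA mB).
by rewrite setIC.
Qed.

Lemma rcd_integral (k : rcd P U W) (h : TW * TU -> \bar R) :
  (forall z, 0 <= h z) -> measurable_fun setT h ->
  \int[P]_x h (W x, U x) =
  \int[P]_x \int[law_at (rcd_kernel k) (W x)]_u h (W x, u).
Proof.
move=> h0 mh; rewrite -joint_distribution_integral//.
by rewrite (@integral_law _ _ _ _ _ P (rpair W U))// => A mA; exact: rcd_joint.
Qed.

End conditional_law.

Section restricted_law.
Context {R : realType} {dO dW : measure_display} {Om : measurableType dO}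
  {TW : measurableType dW} (P : probability Om R) (W : {mfun Om >-> TW})
  (D : set Om) (mD : measurable D).

(** Its density with respect to the law of [W] is a version of the conditional probability of [D]
    given [W]. *)
Definition restricted_law : set TW -> \bar R := pushforward (mrestr P mD) W.

Let restricted_law0 : restricted_law set0 = 0.
Proof. exact: measure0. Qed.

Let restricted_law_ge0 A : 0 <= restricted_law A.
Proof. exact: measure_ge0. Qed.

Let restricted_law_sigma_additive : semi_sigma_additive restricted_law.
Proof. exact: measure_semi_sigma_additive. Qed.

HB.instance Definition _ := isMeasure.Build _ _ _ restricted_law
  restricted_law0 restricted_law_ge0 restricted_law_sigma_additive.

Lemma restricted_lawE (A : set TW) : restricted_law A = P (W @^-1` A `&` D).
Proof. by []. Qed.

Let mpre (A : set TW) : measurable A -> measurable (W @^-1` A).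
Proof. by move=> mA; rewrite -[X in measurable X]setTI; exact: measurable_funPT. Qed.

Let restricted_law_fin : fin_num_fun restricted_law.
Proof.
move=> A mA; apply: (fin_num_measure P).
by apply: measurableI => //; exact: mpre.
Qed.

HB.instance Definition _ :=
  @Measure_isFinite.Build _ _ _ restricted_law restricted_law_fin.

Lemma restricted_law_dominates : restricted_law `<< distribution P W.
Proof.
apply/null_content_dominatesP => A mA PA; rewrite restricted_lawE.
apply/eqP; rewrite eq_le measure_ge0 andbT -[leRHS]PA.
apply: le_measure => //; rewrite inE; last exact: mpre.
by apply: measurableI => //; exact: mpre.
Qed.

Lemma restricted_law_integral (h : TW -> \bar R) :
  (forall w, 0 <= h w) -> measurable_fun setT h ->
  \int[restricted_law]_w h w = \int[P]_(x in D) h (W x).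
Proof.
move=> h0 mh.
rewrite (ge0_integral_pushforward (measurable_funPT W) (mrestr P mD) measurableT mh)//.
rewrite preimage_setT (@density_integral _ _ _ (mrestr P mD) P \1_D).
- rewrite [RHS]integral_mkcond; apply: eq_integral => x _.
  by rewrite patchE indicE; case: (x \in D); rewrite ?mule1 ?mule0.
- split => // A mA.
  by rewrite integral_indic// setIC.
- by move=> x; exact: h0.
- exact: (measurableT_comp mh).
Qed.

End restricted_law.

Section conditional_laws.
Context {R : realType} {dO dU dV dW : measure_display}
  {Om : measurableType dO} {TU : measurableType dU} {TV : measurableType dV}
  {TW : measurableType dW} (P : probability Om R) (U : {mfun Om >-> TU})
  (V : {mfun Om >-> TV}) (W : {mfun Om >-> TW}).

(** Tonelli puts the [V]-integral outside in each fibre; averaging over the conditional law of [V]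
    given [W] then amounts to evaluating at [V] itself. *)
Lemma joint_kernel_prod_integral (kU : rcd P U W) (kV : rcd P V W)
    (h : TW * (TU * TV) -> \bar R) :
  (forall z, 0 <= h z) -> measurable_fun setT h ->
  \int[joint (kernel_prod (rcd_kernel kU) (rcd_kernel kV))
         (distribution P W)]_z h z =
  \int[P]_x \int[law_at (rcd_kernel kU) (W x)]_u h (W x, (u, V x)).
Proof.
move=> h0 mh; rewrite joint_distribution_integral//.
pose H z := \int[law_at (rcd_kernel kU) z.1]_u h (z.1, (u, z.2)).
have H0 z : 0 <= H z by exact: integral_ge0.
have mH : measurable_fun setT H.
  have mg : measurable_fun setT
      (fun z : (TW * TV) * TU => h (z.1.1, (z.2, z.1.2))).
    apply: (measurableT_comp mh); apply/measurable_fun_pair => /=.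
      exact: (measurableT_comp measurable_fst measurable_fst).
    apply/measurable_fun_pair => //=.
    exact: (measurableT_comp measurable_snd measurable_fst).
  exact: (@measurable_kernel_integral _ _ _ _ _
    (kernel_comp (rcd_kernel kU) measurable_fst) _ (fun z => h0 _) mg).
rewrite [RHS](rcd_integral kV H0 mH).
apply: eq_integral => x _.
rewrite (@fubini_tonelli2 _ _ _ _ _ (law_at (rcd_kernel kU) (W x))
  (law_at (rcd_kernel kV) (W x)) (fun z => h (W x, z)))//.
exact: (measurableT_comp mh).
Qed.

(** On a box, conditional independence gives the integral of gA gB over E. Here gA is k_w(A) almost
    surely, and gB is the density of the law of [W] restricted to V in B, so the integral is the
    expectation of k_W(A) over W in E and V in B. *)
Lemma cond_indep_joint (k : rcd P U W) : cond_indep P U V W ->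
  forall D, measurable D ->
  joint (kernel_comp (rcd_kernel k) measurable_fst) (distribution P (rpair W V)) D =
  P (rpair (rpair W V) U @^-1` D).
Proof.
move=> indep.
apply: (@eq_measure_boxes _ _ _ _ _ _ _
  (joint (kernel_comp (rcd_kernel k) measurable_fst) (distribution P (rpair W V)))
  (distribution P (rpair (rpair W V) U))) => E B A mE mB mA.
have mEB : measurable (E `*` B) by exact: measurableX.
have mV : measurable (V @^-1` B).
  by rewrite -[X in measurable X]setTI; exact: measurable_funPT.
have mW : measurable (W @^-1` E).
  by rewrite -[X in measurable X]setTI; exact: measurable_funPT.
pose kA w := law_at (rcd_kernel k) w A.
have mkA : measurable_fun setT kA by exact: measurable_kernel_eval.
have kA0 w : 0 <= kA w by [].
rewrite -[LHS]/(joint (kernel_comp (rcd_kernel k) measurable_fst)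
  (distribution P (rpair W V)) ((E `*` B) `*` A)) joint_setX//.
have [gA [gB [[igA gAE] [igB gBE] [igAB gABE]]]] := indep A B mA mB.
pose nu := restricted_law P W mV.
have nulam : nu `<< distribution P W by exact: restricted_law_dominates.
have [f fdens] : exists f, is_density nu (distribution P W) f.
  exact: density_exists nulam.
have [mf f0 fE] := fdens.
have mfE : measurable_fun setT (EFin \o f) by exact/measurable_EFinP.
have gAk : ae_eq (distribution P W) setT gA kA.
  apply: integral_ae_eq => // E' _ mE'.
  by rewrite -gAE// (rcd_disintegration k mA mE').
have gBf : ae_eq (distribution P W) setT gB (EFin \o f).
  apply: integral_ae_eq => // E' _ mE'.
  by rewrite -gBE// -fE// /nu restricted_lawE setIC.
transitivity (\int[nu]_(w in E) kA w).
  rewrite [LHS]integral_mkcond [RHS]integral_mkcond restricted_law_integral.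
  - rewrite (@integral_law _ _ _ _ _ P (rpair W V))//; last first.
      apply/(measurable_restrictT _ _).1 => //; apply: measurable_funTS.
      exact: (measurableT_comp mkA measurable_fst).
    rewrite [RHS]integral_mkcond; apply: eq_integral => x _.
    rewrite !patchE in_setX/=.
    have -> : (x \in V @^-1` B) = (V x \in B).
      by apply/idP/idP => /set_mem h; apply/mem_set.
    by case: (V x \in B); rewrite ?andbT ?andbF.
  - by move=> w; exact: erestrict_ge0.
  - by apply/(measurable_restrictT _ _).1 => //; exact: measurable_funTS.
rewrite (density_integral_in fdens)//.
transitivity (P ((U @^-1` A `&` V @^-1` B) `&` W @^-1` E)); last first.
  by congr (P _); apply/seteqP; split => x /= [] [].
rewrite gABE//; apply: ae_eq_integral => //.
- by apply: measurable_funTS; exact: emeasurable_funM.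
- by apply: measurable_funTS; exact: measurable_int igAB.
have [N1 [mN1 N10 sN1]] := gAk.
have [N2 [mN2 N20 sN2]] := gBf.
exists (N1 `|` N2); split.
- exact: measurableU.
- by rewrite measureU0.
- move=> w /= hw; apply/not_notP => /not_orP[N1w N2w]; apply: hw => _.
  have gAw : gA w = kA w.
    by apply/not_notP => h; apply: N1w; apply: sN1 => /= /(_ I).
  have gBw : gB w = (f w)%:E.
    by apply/not_notP => h; apply: N2w; apply: sN2 => /= /(_ I).
  by rewrite gAw gBw.
Qed.

(** Up to permuting coordinates, the two joint laws are law(V,W) (x) P_{U|V,W} and law(V,W) (x)
    P_{U|W}. Disintegrating over (V,W) rather than [W] turns [f] into a density of the conditional
    laws of [U]. *)
Lemma conditional_density (kUV : rcd P (rpair U V) W) (kU : rcd P U W)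
    (kV : rcd P V W) (kU_VW : rcd P U (rpair V W))
    (f : TW * (TU * TV) -> R) :
  countably_generated TU ->
  is_density (joint (rcd_kernel kUV) (distribution P W))
    (joint (kernel_prod (rcd_kernel kU) (rcd_kernel kV)) (distribution P W)) f ->
  \forall x \ae P, is_density (law_at (rcd_kernel kU_VW) (V x, W x))
    (law_at (rcd_kernel kU) (W x)) (fun u => f (W x, (u, V x))).
Proof.
move=> cgU [mf f0 fE].
pose swap (z : (TV * TW) * TU) : TW * (TU * TV) := (z.1.2, (z.2, z.1.1)).
have mswap : measurable_fun setT swap.
  apply/measurable_fun_pair => /=.
    exact: (measurableT_comp measurable_snd measurable_fst).
  apply/measurable_fun_pair => //=.
  exact: (measurableT_comp measurable_fst measurable_fst).
pose swapV (z : TW * (TU * TV)) : (TV * TW) * TU := ((z.2.2, z.1), z.2.1).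
have mswapV : measurable_fun setT swapV.
  apply/measurable_fun_pair => /=.
    apply/measurable_fun_pair => //=.
    exact: (measurableT_comp measurable_snd measurable_snd).
  exact: (measurableT_comp measurable_fst measurable_snd).
apply: (@ae_distribution _ _ _ _ _ P (rpair V W) (fun z =>
  is_density (law_at (rcd_kernel kU_VW) z) (law_at (rcd_kernel kU) z.2)
    (fun u => f (z.2, (u, z.1))))).
apply: (density_disintegration (e := kernel_comp (rcd_kernel kU) measurable_snd)
  (f := f \o swap)) => //.
split => [|z|A mA].
- exact: measurableT_comp.
- exact: f0.
have mA' : measurable (swapV @^-1` A).
  by rewrite -[X in measurable X]setTI; exact: mswapV.
have mfA : measurable_fun setT ((EFin \o f) \_ (swapV @^-1` A)).
  apply/(measurable_restrictT _ _).1 => //; apply: measurable_funTS.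
  exact/measurable_EFinP.
have mfsA : measurable_fun setT ((EFin \o (f \o swap)) \_ A).
  apply/(measurable_restrictT _ _).1 => //; apply: measurable_funTS.
  by apply/measurable_EFinP; exact: measurableT_comp.
rewrite rcd_joint// -[LHS]/(P (rpair W (rpair U V) @^-1` (swapV @^-1` A))).
rewrite -(rcd_joint kUV mA') fE// integral_mkcond joint_kernel_prod_integral//; last first.
  by move=> z; apply: erestrict_ge0 => ? _; rewrite lee_fin.
rewrite [RHS]integral_mkcond joint_distribution_integral// => z.
by apply: erestrict_ge0 => ? _; rewrite lee_fin; exact: f0.
Qed.

End conditional_laws.

(** * Standard Borel spaces *)

Lemma metric_open_ball {R : realType} (M : metricType R) (x : M) (r : R) :
  open (ball x r).
Proof.
rewrite openE => y; rewrite ballEmdist/= => xy.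
apply/nbhs_ballP; exists (r - mdist x y)%R; first by rewrite /= subr_gt0.
move=> z; rewrite !ballEmdist/= => yz.
by rewrite (le_lt_trans (metric_triangle x y z))// -ltrBrDl.
Qed.

(* Balls of radius 1/(j+1) around a countable dense set form a countable base. *)
Lemma separable_countable_base {R : realType} (M : metricType R) (D : set M) :
  countable D -> dense D ->
  exists B : (set M)^nat, (forall n, open (B n)) /\
    forall U, open U -> U = \bigcup_(n in [set n | B n `<=` U]) B n.
Proof.
move=> /countable_injP[g ginj] dD.
(* As [g] is injective on [D], each union is a single ball or empty; it indexes the balls by pairs
   of integers. *)
pose C (ij : nat * nat) :=
  \bigcup_(x in [set x | D x /\ g x = ij.1]) ball x (ij.2.+1%:R^-1 : R).
have oC ij : open (C ij) by apply: bigcup_open => x _; exact: metric_open_ball.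
exists (fun n => if unpickle n is Some ij then C ij else set0); split.
  by move=> n; case: unpickle => // ; exact: open0.
move=> U oU; apply/seteqP; split => [y Uy|y [n /= nU] ny]; last exact: nU.
have /nbhs_ballP[e /= e0 yeU] : nbhs y U by apply: open_nbhs_nbhs.
have [j je] : exists j : nat, (j.+1%:R^-1 < e / 2 :> R)%R.
  have e20 : (0 < e / 2)%R by rewrite divr_gt0.
  by have [j] := ltr_add_invr e20; rewrite add0r => je; exists j.
have yj : ball y (j.+1%:R^-1 : R) y by apply: ballxx; rewrite invr_gt0.
have [x [yx Dx]] := dD (ball y (j.+1%:R^-1 : R)) (ex_intro _ y yj)
  (metric_open_ball _ _).
exists (pickle (g x, j)) => /=; rewrite pickleK; last first.
  by exists x => //; exact: ball_sym.
move=> z [x' [Dx' gx'] /= x'z].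
have xx' : x' = x by apply: ginj => //; exact/mem_set.
apply: yeU; rewrite (splitr e).
apply: (@ball_triangle _ _ x); first exact: le_ball (ltW je) _ yx.
by rewrite -xx'; exact: le_ball (ltW je) _ x'z.
Qed.

(** The preimages of a countable base generate: every open set is a countable union of base sets,
    and through the bijection every measurable set is the preimage of a Borel set. *)
Lemma standard_borel_countably_generated {R : realType} {d : measure_display}
    (T : measurableType d) : standard_borel R T -> countably_generated T.
Proof.
move=> [M [[_ [D cD dD]] [f [f' fK f'K] fmeas]]].
have [B [oB UB]] := separable_countable_base cD dD.
apply: (@countably_generated_family _ _ (fun n => f @^-1` (B n))).
set S := <<s _ >>.
have sS : sigma_algebra setT S by exact: smallest_sigma_algebra.
have oS U : open U -> S (f @^-1` U).
  move=> oU; rewrite (UB U oU).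
  have -> : f @^-1` (\bigcup_(n in [set n | B n `<=` U]) B n) =
      \bigcup_n (if `[< B n `<=` U >] then f @^-1` B n else set0).
    apply/seteqP; split => [x [n /= nU] nx|x [n _]].
      by exists n => //; rewrite asboolT.
    by case: asboolP => // nU nx; exists n.
  case: sS => S0 _ SU; apply: SU => n; case: ifP => // _.
  by apply: sub_sigma_algebra; exists n.
apply/seteqP; split; last first.
  apply: smallest_sub; first exact: sigma_algebra_measurable.
  by move=> _ [n _ <-]; apply/fmeas; apply: sub_sigma_algebra; exact: oB.
move=> A mA; have AE : A = f @^-1` (f' @^-1` A).
  by apply/seteqP; split => x /=; rewrite fK.
rewrite AE; move: mA; rewrite [in X in X -> _]AE => /fmeas.
suff : <<s open >> `<=` [set U | S (f @^-1` U)] by apply.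
apply: smallest_sub => //; case: sS => S0 SC SU; split.
- by rewrite /= preimage_set0.
- by move=> U SU'; rewrite /= setTD preimage_setC -setTD; exact: SC.
- by move=> F SF; rewrite /= preimage_bigcup; exact: SU.
Qed.

(** * Predictive distortion *)

(** A finite difference of the integrals of the positive and negative parts forces both to be
    finite. *)
Lemma integral_fin_num_integrable {R : realType} {d : measure_display}
    {T : measurableType d} (mu : {measure set T -> \bar R}) (h : T -> \bar R) :
  measurable_fun setT h -> \int[mu]_x h x \is a fin_num ->
  mu.-integrable setT h.
Proof.
move=> mh hfin; apply/integrableP; split => //.
by apply/abse_integralP => //; rewrite -fin_num_abs.
Qed.

Section cond_mutual_info.
Context {R : realType} (b : R) (b_gt1 : (1 < b)%R).
Context {dO dU dV dW : measure_display}
  {Om : measurableType dO} {TU : measurableType dU} {TV : measurableType dV}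
  {TW : measurableType dW} (P : probability Om R) (U : {mfun Om >-> TU})
  (V : {mfun Om >-> TV}) (W : {mfun Om >-> TW})
  (kUV : rcd P (rpair U V) W) (kU : rcd P U W) (kV : rcd P V W)
  (cgU : countably_generated TU) (cgV : countably_generated TV).

Lemma cond_mutual_info_joint : cond_mutual_info b kUV kU kV =
  kl b (joint (rcd_kernel kUV) (distribution P W))
    (joint (kernel_prod (rcd_kernel kU) (rcd_kernel kV)) (distribution P W)).
Proof.
by rewrite -(kl_joint b_gt1 P W (rcd_kernel kUV)
  (kernel_prod (rcd_kernel kU) (rcd_kernel kV)) (countably_generated_prod cgU cgV)).
Qed.

Lemma cond_mutual_info_fin_num : cond_mutual_info b kUV kU kV \is a fin_num ->
  exists f : TW * (TU * TV) -> R, [/\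
    is_density (joint (rcd_kernel kUV) (distribution P W))
      (joint (kernel_prod (rcd_kernel kU) (rcd_kernel kV)) (distribution P W)) f,
    P [set x | f (W x, (U x, V x)) = 0%R] = 0,
    P.-integrable setT (fun x => (logb b (f (W x, (U x, V x))))%:E) &
    cond_mutual_info b kUV kU kV =
      \int[P]_x (logb b (f (W x, (U x, V x))))%:E].
Proof.
rewrite cond_mutual_info_joint => klfin.
have [ac|/(kl_notdominated b) klE] := pselect
  (joint (rcd_kernel kUV) (distribution P W) `<<
   joint (kernel_prod (rcd_kernel kU) (rcd_kernel kV)) (distribution P W));
  last by rewrite klE in klfin.
have [f fdens] := density_exists ac; have [mf f0 _] := fdens.
have mZ : measurable_fun setT (rpair W (rpair U V)) by exact: measurable_funPT.
have intE : kl b (joint (rcd_kernel kUV) (distribution P W))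
    (joint (kernel_prod (rcd_kernel kU) (rcd_kernel kV)) (distribution P W)) =
    \int[P]_x (logb b (f (W x, (U x, V x))))%:E.
  rewrite (klE _ fdens) (@integral_law _ _ _ _ _ P (rpair W (rpair U V)))//.
    by move=> A mA; exact: rcd_joint.
  exact: measurable_logb.
exists f; split => //.
- have mf0 : measurable [set z | f z = 0%R].
    exact: measurable_zeros.
  have := density_eq0 fdens.
  rewrite -[X in X = _]/(joint (rcd_kernel kUV) (distribution P W)
    [set z | f z = 0%R]).
  by rewrite rcd_joint.
- apply: integral_fin_num_integrable; last by rewrite -intE.
  by apply: measurable_logb; exact: (measurableT_comp mf mZ).
Qed.

End cond_mutual_info.

Section predictive_distortion.
Context {R : realType} (b : R) (b_gt1 : (1 < b)%R)
  {dO dC dX dF dY : measure_display} {Om : measurableType dO}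
  {TC : measurableType dC} {TX : measurableType dX}
  {TF : measurableType dF} {TY : measurableType dY}
  (cgX : countably_generated TX) (cgF : countably_generated TF)
  (cgY : countably_generated TY) (P : probability Om R)
  (C : {mfun Om >-> TC}) (X : {mfun Om >-> TX})
  (F : {mfun Om >-> TF}) (Y : {mfun Om >-> TY})
  (kF_XC : rcd P F (rpair X C)) (kF_YC : rcd P F (rpair Y C))
  (markov : cond_indep P F Y (rpair X C)).

Let TV : measurableType _ := ((TX * TC) * TY)%type.
Let V : {mfun Om >-> TV} := rpair (rpair X C) Y.
Let YC_of (z : TV) : TY * TC := (z.2, z.1.2).

Let measurable_YC_of : measurable_fun setT YC_of.
Proof.
apply/measurable_fun_pair => //=.
exact: (measurableT_comp measurable_snd measurable_fst).
Qed.

(** Both conditional laws of [F] become kernels on the common space of ((X,C),Y), [kX] ignoring [Y]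
    and [kY] ignoring [X], so that [kl_joint] applies to the pair. *)
Let kX : {mfun TV >-> pprobability TF R} :=
  kernel_comp (rcd_kernel kF_XC) measurable_fst.
Let kY : {mfun TV >-> pprobability TF R} :=
  kernel_comp (rcd_kernel kF_YC) measurable_YC_of.
Let jX : probability (TV * TF)%type R := joint kX (distribution P V).
Let jY : probability (TV * TF)%type R := joint kY (distribution P V).

(** The Markov property enters here. *)
Let jXE (A : set (TV * TF)) : measurable A -> jX A = P (rpair V F @^-1` A).
Proof. exact: (cond_indep_joint kF_XC markov). Qed.

Let pred_distortion_joint : pred_distortion b kF_XC kF_YC = kl b jX jY.
Proof. by rewrite -(kl_joint b_gt1 P V kX kY cgF). Qed.

Lemma pred_distortion_cond_mutual_info
    (kFX_YC : rcd P (rpair F X) (rpair Y C)) (kX_YC : rcd P X (rpair Y C)) :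
  pred_distortion b kF_XC kF_YC = cond_mutual_info b kFX_YC kF_YC kX_YC.
Proof.
rewrite pred_distortion_joint cond_mutual_info_joint//.
pose phi (z : TV * TF) : (TY * TC) * (TF * TX) := (YC_of z.1, (z.2, z.1.1.1)).
pose psi (z : (TY * TC) * (TF * TX)) : TV * TF :=
  (((z.2.2, z.1.2), z.1.1), z.2.1).
have mphi : measurable_fun setT phi.
  apply/measurable_fun_pair => /=.
    exact: (measurableT_comp measurable_YC_of measurable_fst).
  apply/measurable_fun_pair => //=.
  apply: (measurableT_comp measurable_fst).
  exact: (measurableT_comp measurable_fst measurable_fst).
have mpsi : measurable_fun setT psi.
  apply/measurable_fun_pair => /=; last first.
    exact: (measurableT_comp measurable_fst measurable_snd).
  apply/measurable_fun_pair => /=; last first.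
    exact: (measurableT_comp measurable_fst measurable_fst).
  apply/measurable_fun_pair => /=.
    exact: (measurableT_comp measurable_snd measurable_snd).
  exact: (measurableT_comp measurable_snd measurable_fst).
have mpre A : measurable A -> measurable (phi @^-1` A).
  by move=> mA; rewrite -[X in measurable X]setTI; exact: mphi.
apply/esym/(@kl_isomorphism _ _ _ _ _ _ (mfun_of mphi) psi) => //.
- by move=> [[[x c] y] f].
- move=> A mA; rewrite -[RHS]/(jX (phi @^-1` A)) jXE; last exact: mpre.
  exact: (rcd_joint kFX_YC mA).
- move=> A mA; rewrite -[RHS]/(jY (phi @^-1` A)).
  (* The indicator turns the equality of measures into one of integrals, where
     [joint_kernel_prod_integral] replaces the conditional law of [X] given (Y,C) by [X]. *)
  pose IA z : \bar R := (\1_A z)%:E.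
  have IA0 z : 0 <= IA z by rewrite lee_fin.
  have mIA : measurable_fun setT IA.
    by apply/measurable_EFinP; exact: measurable_indic.
  transitivity (\int[joint (kernel_prod (rcd_kernel kF_YC) (rcd_kernel kX_YC))
      (distribution P (rpair Y C))]_z IA z).
    by rewrite integral_indic// setIT.
  transitivity (\int[jY]_z IA (phi z)); last first.
    have -> : \int[jY]_z IA (phi z) = \int[jY]_z (\1_(phi @^-1` A) z)%:E by [].
    by rewrite integral_indic ?setIT//; exact: mpre.
  rewrite joint_kernel_prod_integral// joint_distribution_integral//.
  exact: (measurableT_comp mIA mphi).
Qed.

Lemma cond_mutual_info_pred_distortion (kF_C : rcd P F C) (kX_C : rcd P X C)
    (kY_C : rcd P Y C) (kFX_C : rcd P (rpair F X) C)
    (kFY_C : rcd P (rpair F Y) C) :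
  cond_mutual_info b kFX_C kF_C kX_C \is a fin_num ->
  cond_mutual_info b kFY_C kF_C kY_C \is a fin_num ->
  cond_mutual_info b kFX_C kF_C kX_C =
    cond_mutual_info b kFY_C kF_C kY_C + pred_distortion b kF_XC kF_YC.
Proof.
move=> finX finY.
have [f [fdens fP0 fint fE]] := cond_mutual_info_fin_num b_gt1 cgF cgX finX.
have [g [gdens gP0 gint gE]] := cond_mutual_info_fin_num b_gt1 cgF cgY finY.
have [mf f0 _] := fdens; have [mg g0 _] := gdens.
pose f' (z : TV * TF) := f (z.1.1.2, (z.2, z.1.1.1)).
pose g' (z : TV * TF) := g (z.1.1.2, (z.2, z.1.2)).
have mc : measurable_fun setT (fun z : TV * TF => z.1.1.2).
  apply: (measurableT_comp measurable_snd).
  exact: (measurableT_comp measurable_fst measurable_fst).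
have mf' : measurable_fun setT f'.
  apply: (measurableT_comp mf); apply/measurable_fun_pair => //=.
  apply/measurable_fun_pair => //=.
  apply: (measurableT_comp measurable_fst).
  exact: (measurableT_comp measurable_fst measurable_fst).
have mg' : measurable_fun setT g'.
  apply: (measurableT_comp mg); apply/measurable_fun_pair => //=.
  apply/measurable_fun_pair => //=.
  exact: (measurableT_comp measurable_snd measurable_fst).
pose r z := (f' z / g' z)%R.
have mr : measurable_fun setT r.
  apply: measurable_funM => //.
  by apply: measurable_fun_ge0_inv => // z; exact: g0.
have mg'0 : measurable [set z | g' z = 0%R].
  exact: measurable_zeros.
(* Since [jX] is the law of ((X,C),Y,F), the zeros of g' are [jX]-null, hence null on almost every
   fibre. This is the hypothesis of [density_quotient] with P_{F|C} as reference measure. *)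
have jXg'0 : \forall x \ae P,
    law_at kX (V x) [set u | g' (V x, u) = 0%R] = 0.
  apply: (@ae_distribution _ _ _ _ _ P V
    (fun v => law_at kX v [set u | g' (v, u) = 0%R] = 0)).
  have : ae_eq (distribution P V) setT
      (fun v => law_at kX v (xsection [set z | g' z = 0%R] v)) (cst 0).
    apply/ae_eq_integral_abs => //.
      exact: (measurable_fun_xsection_finite_kernel (kernel_of kX) (mem_set mg'0)).
    have <- : jX [set z | g' z = 0%R] = 0 by rewrite jXE.
    rewrite -[RHS]/(joint kX (distribution P V) [set z | g' z = 0%R]) jointE//.
    by apply: eq_integral => v _; rewrite gee0_abs.
  move=> [N [mN N0 sN]]; exists N; split => // v /= hv; apply: sN => /= /(_ I) h.
  apply: hv; rewrite -[RHS]h; congr (law_at kX v _).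
  by apply/seteqP; split => u; rewrite xsectionE.
have fX := conditional_density kF_XC cgF fdens.
have gY := conditional_density kF_YC cgF gdens.
have rdens : is_density jX jY r.
  apply: density_joint => //; first by move=> z; exact: divr_ge0 (f0 _) (g0 _).
  have [N1 [mN1 N10 sN1]] := fX; have [N2 [mN2 N20 sN2]] := gY.
  have [N3 [mN3 N30 sN3]] := jXg'0.
  exists (N1 `|` N2 `|` N3); split.
  - by apply: measurableU => //; exact: measurableU.
  - by rewrite measureU0//; [rewrite measureU0|exact: measurableU].
  - move=> x /= hx; apply/not_notP => /not_orP[/not_orP[N1x N2x] N3x]; apply: hx.
    apply: (@density_quotient _ _ _ (law_at kX (V x)) (law_at kY (V x))
      (law_at (rcd_kernel kF_C) (C x))).
    + by apply/not_notP => h; apply: N1x; exact: sN1.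
    + by apply/not_notP => h; apply: N2x; exact: sN2.
    + by apply/not_notP => h; apply: N3x; exact: sN3.
have DE : pred_distortion b kF_XC kF_YC = \int[P]_x (logb b (r (V x, F x)))%:E.
  rewrite pred_distortion_joint (klE _ rdens).
  rewrite (@integral_law _ _ _ _ _ P (rpair V F))//.
  exact: measurable_logb.
(* Finiteness of I(F;Y|C) allows it to be added back. *)
suff -> : pred_distortion b kF_XC kF_YC =
    cond_mutual_info b kFX_C kF_C kX_C - cond_mutual_info b kFY_C kF_C kY_C.
  by rewrite addeCA subee// adde0.
rewrite DE fE gE -integralB//.
apply: ae_eq_integral => //.
- apply: measurable_logb.
  exact: (measurableT_comp mr (measurable_funPT (rpair V F))).
- by apply: emeasurable_funB; [exact: measurable_int fint|exact: measurable_int gint].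
have mpre0 (h : TV * TF -> R) : measurable_fun setT h ->
    measurable [set x | h (V x, F x) = 0%R].
  move=> mh; have mhV := measurableT_comp mh (measurable_funPT (rpair V F)).
  exact: measurable_zeros.
(* Off this null set both densities are positive, and the logarithm of the quotient splits. *)
exists ([set x | f' (V x, F x) = 0%R] `|` [set x | g' (V x, F x) = 0%R]); split.
- by apply: measurableU; exact: mpre0.
- by rewrite measureU0//; exact: mpre0.
- move=> x /= hx; apply/not_notP => /not_orP[/eqP fx /eqP gx]; apply: hx => _.
  rewrite /logb /r ln_div ?posrE ?lt_def ?fx ?gx ?f0 ?g0//.
  by rewrite mulrBl.
Qed.

End predictive_distortion.

Theorem theorem3 (R : realType) (b : R) (b_gt1 : (1 < b)%R)
    (dO dC dX dF dY : measure_display) (Om : measurableType dO)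
    (TC : measurableType dC) (TX : measurableType dX)
    (TF : measurableType dF) (TY : measurableType dY)
    (sbC : standard_borel R TC) (sbX : standard_borel R TX)
    (sbF : standard_borel R TF) (sbY : standard_borel R TY)
    (P : probability Om R)
    (C : {mfun Om >-> TC}) (X : {mfun Om >-> TX})
    (F : {mfun Om >-> TF}) (Y : {mfun Om >-> TY})
    (kF_XC : rcd P F (rpair X C)) (kF_YC : rcd P F (rpair Y C))
    (kX_YC : rcd P X (rpair Y C)) (kFX_YC : rcd P (rpair F X) (rpair Y C))
    (kF_C : rcd P F C) (kX_C : rcd P X C) (kY_C : rcd P Y C)
    (kFX_C : rcd P (rpair F X) C) (kFY_C : rcd P (rpair F Y) C)
    (markov : cond_indep P F Y (rpair X C)) :
  pred_distortion b kF_XC kF_YC = cond_mutual_info b kFX_YC kF_YC kX_YC /\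
  (cond_mutual_info b kFX_C kF_C kX_C \is a fin_num ->
   cond_mutual_info b kFY_C kF_C kY_C \is a fin_num ->
   cond_mutual_info b kFX_C kF_C kX_C =
     cond_mutual_info b kFY_C kF_C kY_C + pred_distortion b kF_XC kF_YC).
Proof.
have cgX := standard_borel_countably_generated sbX.
have cgF := standard_borel_countably_generated sbF.
have cgY := standard_borel_countably_generated sbY.
split; first exact: pred_distortion_cond_mutual_info.
exact: cond_mutual_info_pred_distortion.
Qed.
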